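(* Let $n$ be even and let $\rho$ be a density operator on $n$ qubits, $\mathcal{A}=\{A_1,\dots,A_n\}$ with each $\mathcal{H}_{A_i}=\mathbb{C}^2$. Consider the filtration defined by the $2$-deformed total correlation $C_2$. Then $$\widetilde{\mathfrak{X}}_2(\infty)=I_2(\mathcal{A})_\rho=Q_{(n)}^2=\tau_n(\rho).$$
   Context: For nonempty $J\subseteq\mathcal{A}$, $\rho_J$ is the reduced state, $S_2(J)_\rho=1-\operatorname{Tr}\rho_J^2$ (linear entropy), $C_2(J)_\rho=\sum_{v\in J}S_2(\{v\})_\rho-S_2(J)_\rho$, and $I_2(\mathcal{A})_\rho=\sum_{\varnothing\ne J\subseteq\mathcal{A}}(-1)^{|J|-1}S_2(J)_\rho$. Let $\Delta$ be the set of nonempty subsets of $\mathcal{A}$ and $G(\varepsilon)_\rho=\{J\in\Delta:C_2(J)_\rho\le\varepsilon\}$, a filtration of simplicial complexes. Reduced Betti numbers: $\widetilde\beta_k(\varepsilon)=\operatorname{rank}H_k(G(\varepsilon)_\rho;\mathbb{Z}_2)$ for $k>0$, $\widetilde\beta_0(\varepsilon)=\max(\operatorname{rank}H_0(G(\varepsilon)_\rho;\mathbb{Z}_2)-1,0)$; the reduced integrated Euler characteristic is $\widetilde{\mathfrak{X}}_2(\infty)=\sum_{k\ge0}(-1)^k\int_0^\infty\widetilde\beta_k(\varepsilon)d\varepsilon$. Let $\sigma_0=I_2$ and $\sigma_1,\sigma_2,\sigma_3$ the Pauli matrices. For a multi-index $\iota=(i_1,\dots,i_n)\in\{0,1,2,3\}^n$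 set $Q_\iota=\operatorname{Tr}(\rho(\sigma_{i_1}\otimes\cdots\otimes\sigma_{i_n}))$ and let $|\iota|$ be the number of $j$ with $i_j\neq0$. The Minkowski length of the generalized Bloch vector is $Q_{(n)}^2=\frac{1}{2^n}\sum_{\iota\in\{0,1,2,3\}^n}(-1)^{|\iota|}Q_\iota^2$. The $n$-tangle is $\tau_n(\rho)=\operatorname{Tr}(\rho\,\sigma_2^{\otimes n}\rho^*\sigma_2^{\otimes n})$, with $\rho^*$ the entrywise complex conjugate in the computational basis. *)

(* Defs.v *)
(* (with MathComp-Analysis for the Lebesgue integral and
   mathcomp-real-closed for the complex numbers R[i]). *)
From HB Require Import structures.
From mathcomp Require Import all_boot all_order all_algebra.
From mathcomp Require Import all_classical all_reals.
From mathcomp Require Import topology normedtype sequences measure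
  lebesgue_measure lebesgue_integral.
From mathcomp Require Import complex.

Set Implicit Arguments.
Unset Strict Implicit.
Unset Printing Implicit Defensive.

Import Order.TTheory GRing.Theory Num.Theory.
Local Open Scope ring_scope.

(* ---------- n-qubit states ---------- *)

(* Computational basis of n qubits: bit strings indexed by the qubits
   A_1..A_n = 'I_n ; false = |0>, true = |1>. *)
Definition basis (n : nat) := {ffun 'I_n -> bool}.

(* Operators on (C^2)^{(x) n}, as matrices in the computational basis. *)
Definition op (R : rcfType) (n : nat) := basis n -> basis n -> R[i].

Definition trace (R : rcfType) (n : nat) (A : op R n) : R[i] :=
  \sum_(x : basis n) A x x.

(* density operator: Hermitian, positive semidefinite, unit trace *)
Definition density (R : rcfType) (n : nat) (rho : op R n) : Prop :=
  [/\ (forall x y, rho y x = (rho x y)^*),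
      (forall v : basis n -> R[i],
          0 <= \sum_(x : basis n) \sum_(y : basis n) (v x)^* * rho x y * v y)
    & trace rho = 1].

(* ---------- reduced states and entropic quantities ---------- *)

(* computational basis of the subsystem J *)
Definition sbasis (n : nat) (J : {set 'I_n}) := {ffun {i : 'I_n | i \in J} -> bool}.

Definition restr (n : nat) (J : {set 'I_n}) (x : basis n) : sbasis J :=
  [ffun i => x (val i)].

(* reduced state rho_J = Tr_{A \ J} rho (partial trace over the complement) *)
Definition rdm (R : rcfType) (n : nat) (rho : op R n) (J : {set 'I_n})
  (a b : sbasis J) : R[i] :=
  \sum_(x : basis n | restr J x == a)
   \sum_(y : basis n | (restr J y == b) && [forall i, (i \notin J) ==> (x i == y i)])
     rho x y.

(* linear entropy S_2(J) = 1 - Tr rho_J^2 *)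
Definition S2 (R : rcfType) (n : nat) (rho : op R n) (J : {set 'I_n}) : R[i] :=
  1 - \sum_(a : sbasis J) \sum_(b : sbasis J) rdm rho a b * rdm rho b a.

(* 2-deformed total correlation *)
Definition C2 (R : rcfType) (n : nat) (rho : op R n) (J : {set 'I_n}) : R[i] :=
  \sum_(v in J) S2 rho [set v] - S2 rho J.

(* 2-deformed multivariate mutual information I_2(A) *)
Definition I2 (R : rcfType) (n : nat) (rho : op R n) : R[i] :=
  \sum_(J : {set 'I_n} | J != finset.set0) (-1) ^+ (#|J|.-1) * S2 rho J.

(* ---------- Pauli quantities ---------- *)

(* sigma_0 = I, sigma_1 = X, sigma_2 = Y, sigma_3 = Z *)
Definition pauli (R : rcfType) (k : 'I_4) (a b : bool) : R[i] :=
  match val k with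
  | 0%N => if a == b then 1 else 0
  | 1%N => if a == b then 0 else 1
  | 2%N => if a == b then 0 else if a then Complex 0 1 else Complex 0 (-1)
  | _ => if a == b then (if a then -1 else 1) else 0
  end.

(* sigma_{i_1} (x) ... (x) sigma_{i_n} *)
Definition pauli_tens (R : rcfType) (n : nat) (iota : {ffun 'I_n -> 'I_4}) : op R n :=
  fun x y => \prod_(j : 'I_n) @pauli R (iota j) (x j) (y j).

Definition opmul (R : rcfType) (n : nat) (A B : op R n) : op R n :=
  fun x y => \sum_(z : basis n) A x z * B z y.

(* Q_iota = Tr(rho (sigma_{i_1} (x) ... (x) sigma_{i_n})) *)
Definition Qcoef (R : rcfType) (n : nat) (rho : op R n) (iota : {ffun 'I_n -> 'I_4}) : R[i] :=
  trace (opmul rho (@pauli_tens R n iota)).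

(* |iota| = number of j with i_j <> 0 *)
Definition weight (n : nat) (iota : {ffun 'I_n -> 'I_4}) : nat :=
  #|[set j | val (iota j) != 0%N]|.

(* Minkowski length Q_(n)^2 of the generalized Bloch vector *)
Definition Qmink2 (R : rcfType) (n : nat) (rho : op R n) : R[i] :=
  (2 ^+ n)^-1 * \sum_(iota : {ffun 'I_n -> 'I_4})
                   (-1) ^+ (weight iota) * (Qcoef rho iota) ^+ 2.

(* n-tangle tau_n(rho) = Tr(rho sigma_2^{(x)n} rho^* sigma_2^{(x)n}) *)
Definition sigma2_tens (R : rcfType) (n : nat) : op R n :=
  @pauli_tens R n [ffun _ => inord 2].

Definition tangle (R : rcfType) (n : nat) (rho : op R n) : R[i] :=
  trace (opmul (opmul (opmul rho (@sigma2_tens R n)) (fun x y => (rho x y)^*))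
               (@sigma2_tens R n)).

(* ---------- the C_2 filtration and its Z_2 homology ---------- *)

(* k-simplices of G(eps) = { J nonempty | C_2(J) <= eps } : those J with |J| = k+1 *)
Definition simp (R : rcfType) (n : nat) (rho : op R n) (eps : R) (k : nat)
  : {set {set 'I_n}} :=
  [set J : {set 'I_n} | [&& J != finset.set0, #|J| == k.+1 & C2 rho J <= (eps%:C)%C]].

(* boundary map d_{k+1} : C_{k+1} -> C_k over Z_2 (row-vector convention):
   entry (s, t) = 1 iff the k-simplex t is a face of the (k+1)-simplex s *)
Definition bdry (R : rcfType) (n : nat) (rho : op R n) (eps : R) (k : nat)
  : 'M['F_2]_(#|simp rho eps k.+1|, #|simp rho eps k|) :=
  \matrix_(s, t)
    (nat_of_bool ((enum_val t : {set 'I_n}) \subset (enum_val s : {set 'I_n})))%:R.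

(* rank H_k(G(eps); Z_2) = dim ker d_k - dim im d_{k+1}  (d_0 = 0) *)
Definition homrank (R : rcfType) (n : nat) (rho : op R n) (eps : R) (k : nat) : nat :=
  match k with
  | 0%N => (#|simp rho eps 0| - \rank (bdry rho eps 0))%N
  | k'.+1 => (\rank (kermx (bdry rho eps k')) - \rank (bdry rho eps k))%N
  end.

(* reduced Betti numbers *)
Definition rbetti (R : rcfType) (n : nat) (rho : op R n) (k : nat) (eps : R) : nat :=
  match k with
  | 0%N => (maxn (homrank rho eps 0) 1 - 1)%N
  | _ => homrank rho eps k
  end.

(* reduced integrated Euler characteristic  sum_k (-1)^k int_0^oo beta_k.
   Simplices have at most n vertices, so beta_k = 0 for k >= n; the sum is
   over k = 0..n. *)
Definition rIEC (R : realType) (n : nat) (rho : op R n) : \bar R :=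
  (\sum_(k < n.+1)
     ((-1) ^+ k)%:E *
     \int[@lebesgue_measure R]_(e in `[0%R, +oo[%classic)
        ((rbetti rho k e)%:R)%:E)%E.

(* Main.v *)
(* Write [Tr (rho_J ^ 2)] as the trace of [rho (x) rho] against the operator
   [SWAP_J] exchanging the qubits of [J] between two copies. Then
   [sum_J (-1)^|J| Tr (rho_J ^ 2)] is the trace of [rho (x) rho] against
   [(1 - SWAP)^(x)n], and on one pair of qubits [1 - SWAP] has entries
   [Y(y,w) Y(z,x)] and equals half of [II - XX - YY - ZZ]; this gives
   [I_2 = tau_n = Q_(n)^2].
   For disjoint [A] and [B], [(1 - SWAP_A)(1 - SWAP_B) >= 0] gives
   [S_2(A u B) <= S_2(A) + S_2(B)], so [C_2] is monotone and [G(eps)] is a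
   complex. By Euler-Poincare its reduced Euler characteristic is
   [sum_J (-1)^|J| [eps < C_2(J)]], whose integral is [sum_J (-1)^|J| C_2(J)];
   the one-qubit terms cancel for [n >= 2], leaving [I_2]. The individual
   integrals are finite since [G(eps)] is the full simplex for large [eps]. *)
Require Import Defs.
From HB Require Import structures.
From mathcomp Require Import all_boot all_order all_algebra.
From mathcomp Require Import all_classical all_reals.
From mathcomp Require Import topology normedtype sequences measure
  lebesgue_measure lebesgue_integral.
From mathcomp Require Import complex.
From mathcomp Require Import spectral sesquilinear numfun ring.

Import Order.TTheory GRing.Theory Num.Theory.
Local Open Scope ring_scope.

(** * Augmented mod 2 chain complexes of families of subsets *)

Section Homology.
Import mathcomp.boot.fintype mathcomp.boot.finset.
Context {n : nat}.
Implicit Types (A B K : {set {set 'I_n}}) (s t u : {set 'I_n}).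

Definition incidence_mx A B : 'M['F_2]_(#|A|, #|B|) :=
  \matrix_(s, t) (nat_of_bool
    ((enum_val t : {set 'I_n}) \subset (enum_val s : {set 'I_n})))%:R.

(** Graded by cardinality: the faces of dimension [k] form [level K k.+1] and the empty face sits in
    level 0, so [boundary_mx K 0] is the augmentation. *)
Definition level K k : {set {set 'I_n}} := [set J in K | #|J| == k].

Definition boundary_mx K k := incidence_mx (level K k.+1) (level K k).

Definition down_closed K := forall s t, s \in K -> t \subset s -> t \in K.

Lemma card_between s t : t \subset s ->
  #|[set u : {set 'I_n} | [&& t \subset u, u \subset s & #|u| == #|t|.+1]]|
  = #|s :\: t|.
Proof.
move=> ts; rewrite -(card_in_imset (f := fun a => a |: t) (D := s :\: t)).
  apply: eq_card => u; rewrite inE; apply/idP/imsetP.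
  - case/and3P => tu us /eqP cu.
    have : #|u :\: t| == 1%N by rewrite cardsDS // cu subSnn.
    case/cards1P => a ua; exists a.
      have : a \in u :\: t by rewrite ua inE.
      by rewrite !inE => /andP[-> /(subsetP us) ->].
    by rewrite -ua setUC -{1}(setIidPr tu) setID.
  - case=> a; rewrite !inE => /andP[ant ain] ->.
    by rewrite subsetUr subUset sub1set ain ts cardsU1 ant /= add1n eqxx.
move=> a b; rewrite !inE => /andP[ant _] /andP[bnt _] /setP/(_ a).
by rewrite !inE eqxx (negbTE ant) !orbF => /esym/eqP.
Qed.

Lemma F2_addrr (x : 'F_2) : x + x = 0.
Proof. by rewrite -mulr2n -mulr_natr pchar_Zp ?mulr0. Qed.

(** An entry counts the sets of size [k.+1] between [t] and [s], all of them in [K]; by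
    [card_between] there are two or none, hence zero mod 2. *)
Lemma boundary_boundary K k : down_closed K ->
  boundary_mx K k.+1 *m boundary_mx K k = 0.
Proof.
move=> dK; apply/matrixP => i j; rewrite !mxE.
under eq_bigr => m _ do rewrite !mxE -natrM mulnb.
set s := enum_val i; set t := enum_val j.
have := enum_valP i; rewrite -/s inE => /andP[sK /eqP cs].
have := enum_valP j; rewrite -/t inE => /andP[tK /eqP ct].
rewrite -(big_enum_val (fun u : {set 'I_n} => (nat_of_bool ((u \subset s) && (t \subset u)))%:R)).
rewrite -natr_sum.
have -> : (\sum_(u in level K k.+1) ((u \subset s) && (t \subset u)) =
  #|[set u : {set 'I_n} | [&& t \subset u, u \subset s & #|u| == #|t|.+1]]|)%N.
  rewrite -sum1_card big_mkcond [RHS]big_mkcond; apply: eq_bigr => u _.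
  rewrite !inE ct; case: (boolP (u \subset s)) => us; rewrite ?andbF /=; last first.
    by case: ifP.
  by rewrite (dK s) //=; case: (t \subset u); case: (_ == _).
have [ts|nts] := boolP (t \subset s); last first.
  rewrite (_ : [set u | _] = finset.set0) ?cards0 //.
  apply/setP => u; rewrite !inE; apply/negP => /and3P[tu us _].
  by move/negP: nts; apply; apply: subset_trans us.
by rewrite card_between // cardsDS // cs ct -(addn2 k) addKn pchar_Zp.
Qed.

Lemma boundary_rank_le K k : down_closed K ->
  (\rank (boundary_mx K k) + \rank (boundary_mx K k.+1) <= #|level K k.+1|)%N.
Proof. by move=> dK; rewrite addnC; apply/mulmx0_rank_max/boundary_boundary. Qed.

(* The cone with apex [v] is a contracting homotopy of the full simplex. *)
Lemma boundary_rank_full (v : 'I_n) k :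
  let K := [set: {set 'I_n}] in
  (\rank (boundary_mx K k) + \rank (boundary_mx K k.+1))%N = #|level K k.+1|.
Proof.
move=> K; apply/eqP; rewrite eqn_leq boundary_rank_le //=; last by move=> *; rewrite inE.
pose cone (j : nat) : 'M['F_2]_(#|level K j|, #|level K j.+1|) :=
  \matrix_(s, t) (nat_of_bool
    ((v \notin (enum_val s : {set 'I_n})) &&
     ((enum_val t : {set 'I_n}) == v |: (enum_val s : {set 'I_n}))))%:R.
have homotopy : cone k.+1 *m boundary_mx K k.+1 + boundary_mx K k *m cone k = 1%:M.
  apply/matrixP => i j; rewrite !mxE.
  set s := enum_val i; set u := enum_val j.
  have := enum_valP i; rewrite -/s !inE /= => /eqP cs.
  have := enum_valP j; rewrite -/u !inE /= => /eqP cu.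
  have eqsu : (i == j) = (s == u) by rewrite (inj_eq enum_val_inj).
  under eq_bigr => m _ do rewrite !mxE -natrM mulnb.
  under [X in _ + X]eq_bigr => m _ do rewrite !mxE -natrM mulnb.
  rewrite -(big_enum_val (fun t : {set 'I_n} =>
    (nat_of_bool (((v \notin s) && (t == v |: s)) && (u \subset t)))%:R)).
  rewrite -(big_enum_val (fun t : {set 'I_n} =>
    (nat_of_bool ((t \subset s) && ((v \notin t) && (u == v |: t))))%:R)).
  have -> : \sum_(t in level K k.+2)
      (nat_of_bool (((v \notin s) && (t == v |: s)) && (u \subset t)))%:R =
      (nat_of_bool ((v \notin s) && (u \subset v |: s)))%:R :> 'F_2.
    have [vs|vs] /= := boolP (v \in s); first by rewrite big1.
    rewrite (bigD1 (v |: s)) /=; last by rewrite !inE cardsU1 vs cs /= add1n eqxx.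
    by rewrite eqxx big1 ?addr0 // => t /andP[_ /negbTE ->].
  have -> : \sum_(t in level K k)
      (nat_of_bool ((t \subset s) && ((v \notin t) && (u == v |: t))))%:R =
      (nat_of_bool ((v \in u) && (u :\ v \subset s)))%:R :> 'F_2.
    have [vu|vu] := boolP (v \in u); last first.
      rewrite big1 // => t _; case: eqP => [ut|_]; last by rewrite !andbF.
      by rewrite ut setU11 in vu.
    rewrite (bigD1 (u :\ v)) /=; last first.
      by rewrite !inE; move: (cardsD1 v u); rewrite vu cu add1n => -[<-]; rewrite eqxx.
    rewrite setD11 setD1K // eqxx /= andbT big1 ?addr0 // => t /andP[_ tu].
    case: (boolP (v \in t)) => vt; rewrite ?andbF //=.
    case: eqP => ut; rewrite ?andbF //.
    by move/eqP: tu; case; rewrite ut setU1K.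
  have sub_eq (a b : {set 'I_n}) : #|a| = k.+1 -> #|b| = k.+1 -> (a \subset b) = (b == a).
    by move=> ca cb; rewrite eq_sym eqEcard ca cb leqnn andbT.
  rewrite eqsu -(sub_eq u s cu cs) -(subDset u [set v] s).
  (* The two terms agree when [v] lies in [u] but not in [s], and cancel mod 2; otherwise at most
     one can be nonzero, and their sum tests [u == s]. *)
  case: (boolP (v \in s)) => vs /=; case: (boolP (v \in u)) => vu /=.
  - by rewrite add0r subDset (setUidPr _) // sub1set.
  - by rewrite addr0; case: (boolP (u \subset s)) => //; rewrite sub_eq // => /eqP E;
      rewrite -E vs in vu.
  - rewrite F2_addrr; case: (boolP (u \subset s)) => // /subsetP/(_ _ vu) E.
    by rewrite E in vs.
  - by rewrite addr0 (setDidPl _) // disjoint_sym disjoints1.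
(* On a cycle the summand through [boundary_mx K k] dies, so the homotopy exhibits the cycle as a
   boundary. *)
have : (kermx (boundary_mx K k) <= boundary_mx K k.+1)%MS.
  rewrite -[kermx _]mulmx1 -homotopy mulmxDr [X in _ + X]mulmxA mulmx_ker mul0mx addr0.
  by rewrite mulmxA submxMl.
by move/mxrankS; rewrite mxrank_ker leq_subLR.
Qed.

(** Rank-nullity form of the homology dimension. On a down-closed family [boundary_rank_le] makes
    both truncated subtractions exact. *)
Definition reduced_betti K k : nat :=
  (#|level K k.+1| - \rank (boundary_mx K k) - \rank (boundary_mx K k.+1))%N.

Lemma reduced_betti_full (v : 'I_n) k : reduced_betti [set: {set 'I_n}] k = 0%N.
Proof. by rewrite /reduced_betti -subnDA (boundary_rank_full v) subnn. Qed.

Lemma level0 K : finset.set0 \in K -> level K 0 = [set finset.set0].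
Proof.
move=> K0; apply/setP => s; rewrite !inE cards_eq0 andbC.
by case: eqP => // ->; rewrite K0.
Qed.

(** The empty set is the only column, and the vertex [v] has it as a face. This rank is the 1
    subtracted in the reduced zeroth Betti number. *)
Lemma rank_augmentation K (v : 'I_n) :
  finset.set0 \in K -> [set v] \in K -> \rank (boundary_mx K 0) = 1%N.
Proof.
move=> K0 Kv; have l0 := level0 _ K0.
apply/eqP; rewrite eqn_leq; apply/andP; split.
  by apply: leq_trans (rank_leq_col _) _; rewrite l0 cards1.
rewrite lt0n mxrank_eq0; apply/eqP => /matrixP E.
have v1 : [set v] \in level K 1 by rewrite inE Kv cards1.
have v0 : finset.set0 \in level K 0 by rewrite l0 inE.
have := E (enum_rank_in v1 [set v]) (enum_rank_in v0 finset.set0).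
by rewrite !mxE !enum_rankK_in // finset.sub0set.
Qed.

Lemma sum_level (V : nmodType) (F : {set 'I_n} -> V) m K : (n <= m)%N ->
  \sum_(s in K) F s = \sum_(k < m.+1) \sum_(s in level K k) F s.
Proof.
move=> nm; rewrite (partition_big (fun s : {set 'I_n} => inord #|s| : 'I_m.+1) predT) //=.
apply: eq_bigr => k _; apply: eq_bigl => s.
by rewrite !inE -val_eqE /= inordK // ltnS (leq_trans (max_card _)) // card_ord.
Qed.

(** Each boundary rank occurs in two consecutive Betti numbers and telescopes away; what is left at
    the bottom, [f 0 - r 0], is [1 - 1]. *)
Lemma reduced_euler (R : comNzRingType) (v : 'I_n) K : down_closed K ->
  finset.set0 \in K -> [set v] \in K ->
  \sum_(k < n.+1) (-1) ^+ k * (reduced_betti K k)%:R =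
  - \sum_(s in K) (-1) ^+ #|s| :> R.
Proof.
move=> dK K0 Kv.
pose f k : R := #|level K k|%:R.
pose r k : R := (\rank (boundary_mx K k))%:R.
have bE k : (reduced_betti K k)%:R = f k.+1 - r k - r k.+1.
  have le_r := boundary_rank_le _ k dK.
  by rewrite /reduced_betti -subnDA natrB // natrD opprD addrA.
under eq_bigr => k _ do rewrite bE.
have tele m : \sum_(k < m) (-1) ^+ k * (f k.+1 - r k - r k.+1) =
    f 0%N - r 0%N + (-1) ^+ m * r m - \sum_(k < m.+1) (-1) ^+ k * f k.
  elim: m => [|m IH]; first by rewrite big_ord0 big_ord1 !expr0 !mul1r addrNK subrr.
  by rewrite big_ord_recr IH [in RHS]big_ord_recr /= exprS; ring.
rewrite tele /r.
(* No subset of ['I_n] has [n.+1] elements, so this matrix has no columns. *)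
have -> : \rank (boundary_mx K n.+1) = 0%N.
  apply/eqP; rewrite -leqn0; apply: leq_trans (rank_leq_col _) _.
  rewrite leqn0 cards_eq0; apply/eqP/setP => s; rewrite !inE.
  apply/negP => /andP[_ /eqP E]; have := max_card (mem s).
  by rewrite card_ord E ltnn.
rewrite (rank_augmentation _ _ K0 Kv) /f.
rewrite level0 // cards1 subrr mulr0 add0r sub0r; congr (- _).
rewrite (sum_level _ _ n.+1) //; apply: eq_bigr => k _.
rewrite (eq_bigr (fun=> (-1) ^+ k)); first by rewrite sumr_const mulr_natr.
by move=> s; rewrite inE => /andP[_ /eqP ->].
Qed.

End Homology.

(** * Gram vectors of positive operators, and a positivity inequality *)

Section Gram.
Import mathcomp.boot.fintype mathcomp.boot.finset.
Variable C : numClosedFieldType.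

(** Diagonalize by the spectral theorem and scale the eigenvectors by square roots of the
    eigenvalues. *)
Lemma psd_gram (X : finType) (A : X -> X -> C) :
  (forall x y, A y x = (A x y)^*) ->
  (forall v : X -> C, 0 <= \sum_x \sum_y (v x)^* * A x y * v y) ->
  exists b : 'I_#|X| -> X -> C,
    forall x y, A x y = \sum_k (b k x)^* * b k y.
Proof.
move=> herA psdA.
pose M : 'M[C]_#|X| := \matrix_(i, j) A (enum_val i) (enum_val j).
have Mh : M \is hermsymmx.
  by apply/is_hermitianmxP; rewrite expr0 scale1r; apply/matrixP => i j; rewrite !mxE herA.
have := hermitian_normalmx Mh => /orthomx_spectralP ME.
set P := spectralmx M in ME; set d := spectral_diag M in ME.
have PU : P \is unitarymx by exact: spectral_unitarymx.
have MEij i j : M i j = \sum_k (P k i)^* * d 0 k * P k j.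
  rewrite {1}ME invmx_unitary // mxE; apply: eq_bigr => k _; congr (_ * _).
  by rewrite mul_mx_diag !mxE.
have d0 k : 0 <= d 0 k.
  (* An eigenvalue is the value of the quadratic form at its unit eigenvector, a conjugated row of
     [P]. *)
  have -> : d 0 k = \sum_(x : X) \sum_(y : X)
      ((P k (enum_rank x))^* )^* * A x y * (P k (enum_rank y))^*.
    have E : diag_mx d = P *m M *m invmx P.
      by rewrite ME !mulmxA mulmxV ?unitarymx_unit // mul1mx mulmxK ?unitarymx_unit.
    have -> : d 0 k = (P *m M *m invmx P) k k by rewrite -E mxE eqxx.
    rewrite invmx_unitary // mxE.
    rewrite (reindex (@enum_rank X)) /=; last first.
      by apply: onW_bij; apply: enum_rank_bij.
    rewrite exchange_big /=; apply: eq_bigr => y _.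
    rewrite !mxE mulr_suml (reindex (@enum_rank X)) /=; last first.
      by apply: onW_bij; apply: enum_rank_bij.
    by apply: eq_bigr => x _; rewrite !mxE !enum_rankK conjCK.
  exact: psdA.
exists (fun k x => sqrtC (d 0 k) * P k (enum_rank x)) => x y.
have := MEij (enum_rank x) (enum_rank y); rewrite mxE !enum_rankK => ->.
apply: eq_bigr => k _; rewrite rmorphM /= (@geC0_conj _ (sqrtC _)) ?sqrtC_ge0 ?d0 //.
by have := sqrtCK (d 0 k); set a := sqrtC _ => <-; ring.
Qed.

(* [(1 - f)(1 - g)] is a quarter of its own square, hence positive. *)
Lemma two_involutions_ge0 (X : finType) (f g : X -> X) (phi : X -> C) :
  involutive f -> involutive g -> (forall p, f (g p) = g (f p)) ->
  0 <= \sum_p (phi p)^* * (phi p - phi (f p) - phi (g p) + phi (f (g p))).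
Proof.
move=> fK gK fgC.
pose psi p := phi p - phi (f p) - phi (g p) + phi (f (g p)).
have psif p : psi (f p) = - psi p by rewrite /psi !fgC !fK; ring.
have psig p : psi (g p) = - psi p by rewrite /psi !gK; ring.
have sumf h (hK : involutive h) (hN : forall p, psi (h p) = - psi p) :
    \sum_p (phi (h p))^* * psi p = - \sum_p (phi p)^* * psi p.
  rewrite (reindex_inj (inv_inj hK)) -sumrN; apply: eq_bigr => p _.
  by rewrite hK hN mulrN.
rewrite -[X in 0 <= X]/(\sum_p (phi p)^* * psi p).
(* [psi] is odd under [f] and [g], so each of the four terms of [(psi p)^*] contributes the same
   sum; hence the 4. *)
rewrite -(@pmulr_rge0 _ 4) ?ltr0n //.
suff -> : 4 * (\sum_p (phi p)^* * psi p) = \sum_p psi p * (psi p)^*.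
  by apply: sumr_ge0 => p _; exact: mul_conjC_ge0.
have fgf : \sum_p (phi (f (g p)))^* * psi p = \sum_p (phi p)^* * psi p.
  rewrite (reindex_inj (inv_inj gK)) (reindex_inj (inv_inj fK)) /=.
  by apply: eq_bigr => p _; rewrite gK fK -fgC psif psig opprK.
transitivity (\sum_p (phi p)^* * psi p - \sum_p (phi (f p))^* * psi p
   - \sum_p (phi (g p))^* * psi p + \sum_p (phi (f (g p)))^* * psi p).
  by rewrite fgf (sumf f) // (sumf g) //; ring.
rewrite -!sumrB -big_split; apply: eq_bigr => p _ /=.
have -> : (psi p)^* = (phi p)^* - (phi (f p))^* - (phi (g p))^* + (phi (f (g p)))^*.
  by rewrite rmorphD !rmorphB.
by ring.
Qed.

End Gram.

(** * Alternating sums over subsets *)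

Section Signs.
Import mathcomp.boot.fintype mathcomp.boot.finset.
Variables (C : comNzRingType) (I : finType).

Lemma prod_nat_of_bool (b : I -> bool) :
  \prod_i (nat_of_bool (b i))%:R = (nat_of_bool [forall i, b i])%:R :> C.
Proof.
case: forallP => [ball|nb]; first by rewrite big1 // => i _; rewrite ball.
have /existsP[i bi] : [exists i, ~~ b i] by rewrite -negb_forall; apply/forallP.
by rewrite (bigD1 i) //= (negbTE bi) mul0r.
Qed.

(** When the product is expanded, [J] is the set of indices where [- F i] is chosen. *)
Lemma signed_subset_prod (F G : I -> C) :
  \sum_(J : {set I}) (-1) ^+ #|J| * \prod_i (if i \in J then F i else G i) =
  \prod_i (G i - F i).
Proof.
under [RHS]eq_bigr => i _ do rewrite addrC.
rewrite bigA_distr /=; apply: eq_bigr => J _.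
rewrite -prodr_const big_mkcond -big_split /=; apply: eq_bigr => i _.
by case: ifP; rewrite ?mulN1r ?mul1r.
Qed.

Lemma sum_signs (i0 : I) : \sum_(J : {set I}) (-1) ^+ #|J| = 0 :> C.
Proof.
have := signed_subset_prod (fun=> 1) (fun=> 1).
rewrite [X in _ = X](bigD1 i0) //= subrr mul0r => E; rewrite -[RHS]E.
by apply: eq_bigr => J _; rewrite big1 ?mulr1 // => i _; case: ifP.
Qed.

(** With [G] the indicator of [i != v], the products select the [J] containing [v], while the factor
    at [w] on the other side is [1 - 1]. *)
Lemma sum_signs_mem (v w : I) : v != w ->
  \sum_(J : {set I} | v \in J) (-1) ^+ #|J| = 0 :> C.
Proof.
move=> vw.
have := signed_subset_prod (fun=> 1) (fun i => (nat_of_bool (i != v))%:R).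
rewrite [X in _ = X](bigD1 w) //= eq_sym vw subrr mul0r => E; rewrite -[RHS]E.
rewrite big_mkcond; apply: eq_bigr => J _; case: ifP => vJ.
  rewrite big1 ?mulr1 // => i _; case: ifP => // iJ; case: eqP => // iv.
  by rewrite iv vJ in iJ.
by rewrite [X in _ * X](bigD1 v) //= vJ eqxx mul0r mulr0.
Qed.

End Signs.

(** * Swap operators, purity, and the two-copy form of the invariants *)

Section Purity.
Import mathcomp.boot.fintype mathcomp.boot.finset.
Context {R : rcfType} {n : nat}.
Implicit Types (rho : op R n) (J A B : {set 'I_n}) (x y z w : Defs.basis n).
Local Notation pairs := (Defs.basis n * Defs.basis n)%type.
Local Notation C := R[i].

Definition mix J x z : Defs.basis n := [ffun i => if i \in J then z i else x i].

Definition swap J (p : pairs) : pairs := (mix J p.1 p.2, mix J p.2 p.1).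

Lemma swapK J : involutive (swap J).
Proof.
by case=> x z; congr pair; apply/ffunP => i; rewrite !ffunE; case: (i \in J).
Qed.

Lemma swap0 p : swap finset.set0 p = p.
Proof. by case: p => x z; congr pair; apply/ffunP => i; rewrite !ffunE inE. Qed.

Lemma swapU A B p : [disjoint A & B] -> swap A (swap B p) = swap (A :|: B) p.
Proof.
move=> dAB; case: p => x z; congr pair; apply/ffunP => i; rewrite !ffunE inE;
  by case: (boolP (i \in A)) => //= iA; rewrite (disjointFr dAB iA).
Qed.

(* [Tr (rho_J ^ 2)], written as [Tr ((rho (x) rho) SWAP_J)]. *)
Definition purity rho J : C :=
  \sum_(p : pairs) rho p.1 (swap J p).1 * rho p.2 (swap J p).2.

Lemma S2E rho J : S2 rho J = 1 - purity rho J.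
Proof.
congr (_ - _).
pose G x (b : sbasis J) := \sum_(y : Defs.basis n |
  (restr J y == b) && [forall i, (i \notin J) ==> (x i == y i)]) rho x y.
(* Given [x], the bits of [y] in [J] are fixed by [b] and the others by [x], so the inner sum of the
   partial trace has a single term. *)
have GE x z : G x (restr J z) = rho x (mix J x z).
  rewrite /G (big_pred1 (mix J x z)) // => y /=; apply/andP/eqP.
  - case=> /eqP/ffunP yz /forallP xy; apply/ffunP => i; rewrite ffunE.
    case: ifP => iJ; last by have := xy i; rewrite iJ => /eqP.
    by have := yz (Sub i iJ); rewrite !ffunE.
  - move=> ->; split.
      by apply/eqP/ffunP => i; rewrite !ffunE (valP i).
    by apply/forallP => i; apply/implyP => /negbTE iJ; rewrite ffunE iJ.
rewrite /purity -(pair_bigA _ (fun x z => rho x (mix J x z) * rho z (mix J z x))) /=.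
rewrite (partition_big (restr J) predT) //=; apply: eq_bigr => a _.
transitivity (\sum_(b : sbasis J) \sum_(x | restr J x == a) G x b *
    \sum_(z | restr J z == b) G z a).
  by apply: eq_bigr => b _; rewrite mulr_suml.
rewrite exchange_big /=; apply: eq_bigr => x /eqP xa.
rewrite [RHS](partition_big (restr J) predT) //=; apply: eq_bigr => b _.
rewrite mulr_sumr; apply: eq_bigr => z /eqP zb.
by rewrite -GE -GE xa zb.
Qed.

Lemma purity0 rho : trace rho = 1 -> purity rho finset.set0 = 1.
Proof.
move=> tr1; rewrite /purity; under eq_bigr => p _ do rewrite swap0.
rewrite -(pair_bigA _ (fun x z => rho x x * rho z z)) /=.
under eq_bigr => x _ do rewrite -mulr_sumr -/(trace rho) tr1 mulr1.
exact: tr1.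
Qed.

Lemma purity_real rho J : (forall x y, rho y x = (rho x y)^*) ->
  purity rho J \is Num.real.
Proof.
move=> her; apply/CrealP; rewrite /purity rmorph_sum.
rewrite (reindex_inj (inv_inj (swapK J))); apply: eq_bigr => p _.
by rewrite swapK rmorphM; congr (_ * _); apply/esym/her.
Qed.

(** With Gram vectors [b k] of [rho], each purity is a sum over [k], [l] of the expectation of
    [SWAP_J] at [phi k l], the tensor product of [b k] and [b l]. Reading 1 as the purity of the
    empty set, [two_involutions_ge0] applies to each pair [k], [l]. *)
Lemma purity_subadd rho A B : density rho -> [disjoint A & B] ->
  0 <= 1 - purity rho A - purity rho B + purity rho (A :|: B).
Proof.
case=> her psd tr1 dAB; have [b bE] := psd_gram _ _ _ her psd.
rewrite -(purity0 rho tr1).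
pose phi k l (p : pairs) := b k p.1 * b l p.2.
have pE J : purity rho J = \sum_k \sum_l \sum_p (phi k l p)^* * phi k l (swap J p).
  rewrite /purity; under [RHS]eq_bigr => k _ do rewrite exchange_big /=.
  rewrite [RHS]exchange_big /=; apply: eq_bigr => p _.
  rewrite !bE mulr_suml; apply: eq_bigr => k _; rewrite mulr_sumr.
  by apply: eq_bigr => l _; rewrite /phi rmorphM /=; ring.
rewrite !pE -!sumrB -big_split /=; apply: sumr_ge0 => k _.
rewrite -!sumrB -big_split /=; apply: sumr_ge0 => l _.
rewrite -!sumrB -big_split /=.
have BA : [disjoint B & A] by rewrite disjoint_sym.
have := @two_involutions_ge0 _ _ (swap A) (swap B) (phi k l) (swapK A) (swapK B).
have -> // : \sum_p (phi k l p)^* * (phi k l p - phi k l (swap A p) -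
    phi k l (swap B p) + phi k l (swap A (swap B p))) =
  \sum_i ((phi k l i)^* * phi k l (swap finset.set0 i) -
    (phi k l i)^* * phi k l (swap A i) - (phi k l i)^* * phi k l (swap B i) +
    (phi k l i)^* * phi k l (swap (A :|: B) i)).
  by apply: eq_bigr => p _; rewrite swap0 swapU //; ring.
by apply=> p; rewrite !swapU // setUC.
Qed.

(** Two copies of [rho] traced against a tensor product of two-qubit operators, one per site: the
    common form of the alternating purity sum, the tangle and the Minkowski length. *)
Definition site_form rho (E : bool -> bool -> bool -> bool -> C) : C :=
  \sum_(p : pairs) \sum_(q : pairs) rho p.1 q.1 * rho p.2 q.2 *
    \prod_i E (p.1 i) (p.2 i) (q.1 i) (q.2 i).

(* Entry of [1 - SWAP] on two qubits, in row [(x, z)] and column [(y, w)]. *)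
Definition antisym (x z y w : bool) : C :=
  (nat_of_bool ((x == y) && (z == w)))%:R - (nat_of_bool ((x == w) && (z == y)))%:R.

(** The matrix of [SWAP_J] is a product over sites, of swaps on [J] and identities off it, so the
    signed sum over [J] factorizes site by site. *)
Lemma sum_sign_purity rho :
  \sum_(J : {set 'I_n}) (-1) ^+ #|J| * purity rho J = site_form rho antisym.
Proof.
pose F (p q : pairs) i : C := (nat_of_bool ((p.1 i == q.2 i) && (p.2 i == q.1 i)))%:R.
pose G (p q : pairs) i : C := (nat_of_bool ((p.1 i == q.1 i) && (p.2 i == q.2 i)))%:R.
have pE J : purity rho J = \sum_(p : pairs) \sum_(q : pairs)
    rho p.1 q.1 * rho p.2 q.2 * \prod_i (if i \in J then F p q i else G p q i).
  apply: eq_bigr => p _; rewrite (bigD1 (swap J p)) //= [X in _ + X]big1 ?addr0.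
    rewrite big1 ?mulr1 // => i _; rewrite /F /G /= !ffunE.
    by case: (i \in J); rewrite !eqxx.
  move=> q qp; rewrite (eq_bigr (fun i => (nat_of_bool (if i \in J then
      (p.1 i == q.2 i) && (p.2 i == q.1 i)
      else (p.1 i == q.1 i) && (p.2 i == q.2 i)))%:R)); last by move=> i _; case: ifP.
  rewrite prod_nat_of_bool; case: forallP => [H|]; last by rewrite mulr0.
  case/eqP: qp; rewrite [q]surjective_pairing; congr pair; apply/ffunP => i;
    by rewrite ffunE; have := H i; case: (i \in J) => /andP[/eqP e1 /eqP e2].
under eq_bigr => J _ do rewrite pE mulr_sumr.
rewrite exchange_big /=; apply: eq_bigr => p _.
under eq_bigr => J _ do rewrite mulr_sumr.
rewrite exchange_big /=; apply: eq_bigr => q _.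
under eq_bigr => J _ do rewrite mulrCA.
by rewrite -mulr_sumr signed_subset_prod.
Qed.

Lemma tangleE rho : (forall x y, rho y x = (rho x y)^*) ->
  tangle rho = site_form rho antisym.
Proof.
move=> her; rewrite /tangle /trace /opmul /site_form.
rewrite -(pair_bigA _ (fun x z => \sum_(q : pairs) rho x q.1 * rho z q.2 *
    \prod_i antisym (x i) (z i) (q.1 i) (q.2 i))) /=.
apply: eq_bigr => x _; apply: eq_bigr => z _.
rewrite -(pair_bigA _ (fun y w => rho x y * rho z w *
    \prod_i antisym (x i) (z i) (y i) (w i))) /= exchange_big /= mulr_suml.
apply: eq_bigr => w _; rewrite !mulr_suml; apply: eq_bigr => y _.
(* Hermitian symmetry turns the conjugated entry into [rho z w], the second copy. *)
rewrite -her /sigma2_tens /pauli_tens.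
rewrite (eq_bigr (fun i => pauli R (inord 2) (y i) (w i))); last by move=> i _; rewrite ffunE.
rewrite [X in _ * X](eq_bigr (fun i => pauli R (inord 2) (z i) (x i))); last first.
  by move=> i _; rewrite ffunE.
rewrite -!mulrA; congr (_ * _); rewrite mulrCA; congr (_ * _).
rewrite -big_split /=; apply: eq_bigr => i _.
rewrite /pauli /antisym /= inordK //.
(* The one-site identity [Y(y,w) Y(z,x) = antisym x z y w], on all sixteen bit patterns. *)
by case: (x i) (y i) (z i) (w i) => [] [] [] [] /=;
  apply/eqP; rewrite eq_complex /=; apply/andP; split; apply/eqP; ring.
Qed.

(** The sign, the Pauli entries and the power of 2 all split over sites, so the sum over
    multi-indices becomes a product of one-site sums over the four Pauli matrices. *)
Lemma QminkE rho : Qmink2 rho = site_form rho antisym.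
Proof.
have QE iota : Qcoef rho iota ^+ 2 = \sum_(p : pairs) \sum_(q : pairs)
    rho p.1 q.1 * rho p.2 q.2 * \prod_i
     (pauli R (iota i) (q.1 i) (p.1 i) * pauli R (iota i) (q.2 i) (p.2 i)).
  rewrite expr2 /Qcoef /trace /opmul mulr_suml.
  rewrite -(pair_bigA _ (fun x z => \sum_(q : pairs) rho x q.1 * rho z q.2 *
    \prod_i (pauli R (iota i) (q.1 i) (x i) * pauli R (iota i) (q.2 i) (z i)))) /=.
  apply: eq_bigr => x _; rewrite mulr_sumr; apply: eq_bigr => z _.
  rewrite -(pair_bigA _ (fun y w => rho x y * rho z w *
    \prod_i (pauli R (iota i) (y i) (x i) * pauli R (iota i) (w i) (z i)))) /=.
  rewrite mulr_suml; apply: eq_bigr => y _; rewrite mulr_sumr; apply: eq_bigr => w _.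
  by rewrite big_split /= mulrACA.
rewrite /Qmink2.
under eq_bigr => iota _ do rewrite QE mulr_sumr.
rewrite exchange_big /= mulr_sumr; apply: eq_bigr => p _.
under eq_bigr => iota _ do rewrite mulr_sumr.
rewrite exchange_big /= mulr_sumr; apply: eq_bigr => q _.
under eq_bigr => iota _ do rewrite mulrCA.
rewrite -mulr_sumr mulrCA; congr (_ * _).
pose H i (k : 'I_4) : C := (if val k != 0%N then -1 else 1) *
  (pauli R k (q.1 i) (p.1 i) * pauli R k (q.2 i) (p.2 i)).
have HE (iota : {ffun 'I_n -> 'I_4}) : (-1) ^+ weight iota * \prod_i
   (pauli R (iota i) (q.1 i) (p.1 i) * pauli R (iota i) (q.2 i) (p.2 i)) =
   \prod_i H i (iota i).
  rewrite [RHS]big_split /=; congr (_ * _).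
  rewrite /weight -prodr_const big_mkcond /=; apply: eq_bigr => i _.
  by rewrite inE.
transitivity ((2 ^+ n)^-1 * \sum_(iota : {ffun 'I_n -> 'I_4}) \prod_i H i (iota i)).
  by congr (_ * _); apply: eq_bigr => iota _; exact: HE.
rewrite -bigA_distr_bigA /=.
have -> : (2 ^+ n)^-1 = \prod_(i < n) (2^-1 : C) by rewrite prodr_const card_ord exprVn.
rewrite -big_split /=; apply: eq_bigr => i _.
rewrite !big_ord_recl big_ord0 /H /pauli /antisym /=.
have h2 : (2 : C) != 0 by rewrite pnatr_eq0.
have II : Complex 0 1 * Complex 0 1 = -1 :> C.
  by apply/eqP; rewrite eq_complex /=; apply/andP; split; apply/eqP; ring.
have -> : Complex 0 (-1) = - Complex 0 1 :> C.
  by apply/eqP; rewrite eq_complex /= oppr0 !eqxx.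
by case: (p.1 i) (q.1 i) (p.2 i) (q.2 i) => [] [] [] [] /=;
  rewrite ?mulrN ?mulNr ?II; field.
Qed.

End Purity.

(** * Integration along a sublevel filtration *)

Section SublevelIntegral.
Context {R : realType} {T : finType} (c : T -> R).
Implicit Types (S : {set T}) (e : R).
Local Notation mu := (@lebesgue_measure R).

Definition sublevel e : {set T} := [set J | c J <= e]%SET.

(** There are finitely many candidate sublevel sets [S], and each occurs on a finite intersection of
    half-lines. *)
Lemma measurable_sublevel (g : {set T} -> R) (D : set R) : measurable D ->
  measurable_fun D (fun e => g (sublevel e)).
Proof.
move=> mD _ Y mY; apply: measurableI => //.
have -> : ((fun e => g (sublevel e)) @^-1` Y =
    \bigcup_(S in [set S | Y (g S)]) \bigcap_(J in [set: T])
      (if J \in S then `[c J, +oo[%classic else `]-oo, c J[%classic))%classic.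
  apply/seteqP; split => e /=.
    move=> Ye; exists (sublevel e) => // J _; rewrite inE.
    by case: leP => h; rewrite /= in_itv /= ?h.
  move=> [S YS He]; suff -> : sublevel e = S by [].
  apply/setP => J; have := He J I; rewrite inE; case: (J \in S) => /=;
    rewrite in_itv /= ?andbT // => h.
  by apply/negbTE; rewrite -ltNge.
apply: fin_bigcup_measurable => [|S _]; first exact: finite_finset.
apply: fin_bigcap_measurable => [|J _]; first exact: finite_finset.
by case: ifP => _; exact: measurable_itv.
Qed.

Lemma integrable_sublevel (g : {set T} -> R) (M : R) :
  mu.-integrable `[0, M]%classic (fun e => (g (sublevel e))%:E).
Proof.
apply: measurable_bounded_integrable.
- exact: measurable_itv.
- rewrite /= lebesgue_measure_itv /=; case: ifP => _; last exact: ltry.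
  by rewrite -EFinD ltry.
- by apply: measurable_sublevel; exact: measurable_itv.
- exists (\sum_S `|g S|); split; first by rewrite num_real.
  move=> y By e _ /=; apply: le_trans (ltW By).
  by rewrite (bigD1 (sublevel e)) //= lerDl sumr_ge0.
Qed.

(** Beyond [M] all integrands vanish, so each integral is finite on its own and the sum may pass
    inside. There [gsum] leaves the indicators of [[0, c J[], of integral [c J]. *)
Lemma integral_sublevel (m : nat) (a : 'I_m -> R) (g : 'I_m -> {set T} -> R)
    (wt : T -> R) :
  (forall J, 0 <= c J) ->
  (forall k, g k [set: T]%SET = 0) ->
  (forall e, 0 <= e -> \sum_k a k * g k (sublevel e) =
                       \sum_(J | J \notin sublevel e) wt J) ->
  (\sum_(k < m) (a k)%:E *
     \int[mu]_(e in `[0%R, +oo[%classic) (g k (sublevel e))%:E =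
   (\sum_J wt J * c J)%R%:E)%E.
Proof.
move=> c0 gT gsum.
pose M := \sum_J c J.
have cM J : c J <= M by rewrite /M (bigD1 J) //= lerDl sumr_ge0.
have mD : measurable `[0, M]%classic by exact: measurable_itv.
have intD k : (\int[mu]_(e in `[0%R, +oo[%classic) (g k (sublevel e))%:E =
    \int[mu]_(e in `[0%R, M]%classic) (g k (sublevel e))%:E)%E.
  rewrite integral_mkcond [RHS]integral_mkcond; congr (integral _ _ _).
  apply/funext => e; rewrite !patchE; case: (boolP (e \in `[0%R, M]%classic)).
    rewrite !inE /= !in_itv /= => /andP[e0 _].
    by case: ifPn => //; rewrite notin_setE /= in_itv /= e0.
  rewrite notin_setE /= in_itv /= => eM; case: ifPn => //.
  rewrite inE /= in_itv /= andbT => e0.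
  have -> : sublevel e = [set: T]%SET.
    apply/setP => J; rewrite !inE; apply: le_trans (cM J) _.
    by rewrite leNgt; apply/negP => /ltW h; apply: eM; rewrite e0.
  by rewrite gT.
under eq_bigr => k _.
  rewrite intD -integralZl //; last exact: integrable_sublevel.
  over.
rewrite -integral_sum //; last first.
  by move=> k; apply: integrableZl => //; exact: integrable_sublevel.
transitivity (\int[mu]_(e in `[0%R, M]%classic) (\sum_J (wt J)%:E *
    ((nat_of_bool (J \notin sublevel e))%:R)%:E))%E.
  apply: eq_integral => e; rewrite inE /= in_itv /= => /andP[e0 _].
  under eq_bigr => k _ do rewrite -EFinM.
  rewrite sumEFin gsum // big_mkcond -sumEFin; apply: eq_bigr => J _.
  by rewrite -EFinM; case: ifP; rewrite ?mulr1 ?mulr0.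
have intJ J : mu.-integrable `[0, M]%classic
    (fun e => ((nat_of_bool (J \notin sublevel e))%:R)%:E).
  exact: (integrable_sublevel (fun S => (nat_of_bool (J \notin S))%:R)).
rewrite integral_sum //; last by move=> J; apply: integrableZl.
rewrite -sumEFin; apply: eq_bigr => J _; rewrite integralZl // EFinM; congr (_ * _)%E.
transitivity (\int[mu]_(e in `[0%R, M]%classic) (\1_(`[0%R, c J[%classic) e)%:E)%E.
  apply: eq_integral => e; rewrite inE /= in_itv /= => /andP[e0 _].
  rewrite indicE [J \in _]inE -ltNge.
  have -> // : (e \in `[0%R, c J[%classic) = (e < c J).
  by apply/idP/idP; rewrite inE /= in_itv /= e0.
rewrite integral_indic //.
have -> : (`[0%R, c J[ `&` `[0%R, M] = `[0%R, c J[)%classic.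
  apply/setIidPl => e /=; rewrite !in_itv /= => /andP[-> eJ] /=.
  by apply: ltW; apply: lt_le_trans eJ _.
rewrite /= lebesgue_measure_itv /= lte_fin; case: ltP => [_|cJ].
  by rewrite -EFinD subr0.
by congr (_%:E); apply/eqP; rewrite eq_le c0 cJ.
Qed.

End SublevelIntegral.

(** * Monotonicity of [C2] and the Betti numbers of its filtration *)

Section Correlation.
Import mathcomp.boot.fintype mathcomp.boot.finset.
Context {R : rcfType} {n : nat} {rho : op R n} (dens : density rho).

Let her : forall x y, rho y x = (rho x y)^*. Proof. by case: dens. Qed.
Let tr1 : trace rho = 1. Proof. by case: dens. Qed.

Lemma S2_set0 : S2 rho finset.set0 = 0.
Proof. by rewrite S2E purity0 // subrr. Qed.

(** The constant 1 in [S2] drops out because the signs over all subsets sum to zero; the empty set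
    then contributes [1 - 1]. *)
Lemma I2E : (0 < n)%N -> I2 rho = \sum_(J : {set 'I_n}) (-1) ^+ #|J| * purity rho J.
Proof.
move=> n0; have s0 := sum_signs R[i] _ (Ordinal n0).
rewrite -[RHS]subr0 -[X in _ - X]s0 -sumrB /I2.
rewrite [RHS](bigD1 finset.set0) //= purity0 // mulr1 subrr add0r.
apply: eq_bigr => J; rewrite -card_gt0 S2E => cJ.
by rewrite -{2 3}(prednK cJ) exprS; ring.
Qed.

(** The coefficient of [S2 rho [set v]] is the signed count of the sets containing [v], zero once a
    second vertex exists. *)
Lemma sum_sign_C2 : (1 < n)%N ->
  \sum_(J : {set 'I_n}) (-1) ^+ #|J| * C2 rho J =
  \sum_(J : {set 'I_n}) (-1) ^+ #|J| * purity rho J.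
Proof.
move=> n1; have n0 := ltnW n1.
pose i0 : 'I_n := Ordinal n0; pose i1 : 'I_n := Ordinal n1.
have sep (v : 'I_n) : exists w : 'I_n, v != w.
  by case: (eqVneq v i0) => [->|h]; [exists i1 | exists i0].
have sum_S2 : \sum_(J : {set 'I_n}) (-1) ^+ #|J| * (\sum_(v in J) S2 rho [set v]) = 0.
  under eq_bigr => J _ do rewrite mulr_sumr.
  rewrite (exchange_big_dep predT) //= big1 // => v _.
  have [w vw] := sep v.
  by rewrite -mulr_suml (sum_signs_mem R[i] _ _ _ vw) mul0r.
rewrite -[RHS]subr0 -[X in _ - X](sum_signs R[i] _ i0) -[RHS]add0r -[X in X + _]sum_S2.
rewrite -sumrB -big_split; apply: eq_bigr => J _ /=.
by rewrite /C2 S2E; ring.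
Qed.

Lemma C2_real J : C2 rho J \is Num.real.
Proof.
have Sr A : S2 rho A \is Num.real.
  by rewrite S2E rpredB ?rpred1 // purity_real.
by rewrite rpredB // rpred_sum.
Qed.

Lemma C2_set0 : C2 rho finset.set0 = 0.
Proof. by rewrite /C2 big_set0 S2_set0 subrr. Qed.

Lemma C2_set1 v : C2 rho [set v] = 0.
Proof. by rewrite /C2 big_set1 subrr. Qed.

(** The increment is the defect in the subadditivity of [S2] on [[set v]] and [J]. *)
Lemma C2_setU1 v (J : {set 'I_n}) : v \notin J -> C2 rho J <= C2 rho (v |: J).
Proof.
move=> vJ; rewrite -subr_ge0.
have -> : C2 rho (v |: J) - C2 rho J =
    1 - purity rho [set v] - purity rho J + purity rho (v |: J).
  by rewrite /C2 big_setU1 //= !S2E; ring.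
by apply: purity_subadd; rewrite // disjoints1.
Qed.

Lemma C2_mono (A B : {set 'I_n}) : A \subset B -> C2 rho A <= C2 rho B.
Proof.
move: {2}#|B :\: A| (erefl #|B :\: A|) => m; elim: m A => [|m IH] A cm AB.
  suff -> : A = B by [].
  by apply/eqP; rewrite eqEsubset AB -setD_eq0 -cards_eq0 cm.
have /card_gt0P[v] : (0 < #|B :\: A|)%N by rewrite cm.
rewrite inE => /andP[vA vB]; apply: le_trans (C2_setU1 _ _ vA) (IH _ _ _).
  move: cm; rewrite (cardsD1 v) !inE vA vB add1n => -[<-].
  by congr #|pred_of_set _|; rewrite setDDl setUC.
by rewrite subUset sub1set vB.
Qed.

Lemma rbettiE k (e : R) : (0 < n)%N -> 0 <= e ->
  rbetti rho k e = reduced_betti [set J | C2 rho J <= e%:C%C] k.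
Proof.
move=> n0 e0; set K := [set J | _].
have simpE j : simp rho e j = level K j.+1.
  by apply/setP => J; rewrite !inE -card_gt0;
    case: eqP => [->|_]; rewrite ?andbF //= andbT.
have e0C : 0 <= e%:C%C :> R[i] by rewrite lecR.
have dK : down_closed K.
  move=> s t; rewrite !inE => sK ts; apply: le_trans sK; exact: C2_mono.
rewrite /reduced_betti; case: k => [|k]; rewrite /rbetti /homrank.
  rewrite -[bdry rho e 0]/(incidence_mx (simp rho e 1) (simp rho e 0)) !simpE.
  rewrite -/(boundary_mx K 1).
  have := boundary_rank_le _ 0 dK.
  have K0 : finset.set0 \in K by rewrite inE C2_set0.
  have K1 : [set Ordinal n0] \in K by rewrite inE C2_set1.
  rewrite (rank_augmentation _ _ K0 K1) => le1.
  (* By [le1] there are more vertices than the boundary rank, so [homrank] is at least 1 and attains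
     the maximum. *)
  rewrite -subnDA addnC subnDA (maxn_idPl _) //.
  by rewrite leq_subRL ?(leq_trans _ le1) // addnC.
rewrite mxrank_ker.
rewrite -[bdry rho e k]/(incidence_mx (simp rho e k.+1) (simp rho e k)).
rewrite -[bdry rho e k.+1]/(incidence_mx (simp rho e k.+2) (simp rho e k.+1)).
by rewrite !simpE.
Qed.

End Correlation.

(** * Combining the algebraic identities with the integrated Euler characteristic *)

Theorem theorem3 (R : realType) (n : nat) (rho : op R n) :
  (0 < n)%N -> ~~ odd n -> density rho ->
  exists x : R,
    [/\ rIEC rho = x%:E, I2 rho = (x%:C)%C, Qmink2 rho = (x%:C)%C & tangle rho = (x%:C)%C].
Proof.
move=> n0 evn dens.
(* A positive even [n] is at least 2, as the cancellation of the one-qubit terms requires. *)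
have n1 : (1 < n)%N by case: n n0 evn {rho dens} => [|[|]].
pose c (J : {set 'I_n}) : R := complex.Re (C2 rho J).
have cE J : (c J)%:C%C = C2 rho J by rewrite RRe_real // C2_real.
(* The value of the integrated Euler characteristic, with [C2] replaced by its real part [c]. *)
exists (\sum_(J : {set 'I_n}) (-1) ^+ #|J| * c J).
have xE : (\sum_(J : {set 'I_n}) (-1) ^+ #|J| * c J)%:C%C =
    \sum_(J : {set 'I_n}) (-1) ^+ #|J| * purity rho J.
  rewrite -sum_sign_C2 // rmorph_sum; apply: eq_bigr => J _.
  by rewrite rmorphM rmorphXn rmorphN rmorph1 -cE.
rewrite xE I2E // sum_sign_purity QminkE tangleE; last by case: dens.
split=> //.
have KE e : [set J | C2 rho J <= e%:C%C]%SET = sublevel c e.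
  by apply/setP => J; rewrite !inE -cE lecR.
rewrite -(integral_sublevel c n.+1 (fun k => (-1) ^+ k)
    (fun k S => (reduced_betti S k)%:R)).
- apply: eq_bigr => k _; congr (_ * _)%E; apply: eq_integral => e.
  by rewrite inE /= in_itv /= andbT => e0; rewrite rbettiE // KE.
- move=> J; rewrite -lecR cE -[X in X <= _]/(0 : R[i]) -(C2_set0 dens).
  by apply: C2_mono => //; exact: finset.sub0set.
- by move=> k; rewrite (reduced_betti_full (Ordinal n0)).
- move=> e e0; rewrite (reduced_euler _ (Ordinal n0)).
  (* The signs over all subsets sum to zero, so minus the sum over the complex is the sum over the
     sets outside it. *)
  + apply/eqP; rewrite eq_sym -addr_eq0 addrC; apply/eqP.
    by rewrite -[RHS](sum_signs R _ (Ordinal n0)) [RHS](bigID (mem (sublevel c e))).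
  + move=> s t; rewrite -KE !inE => sK ts; apply: le_trans sK.
    exact: C2_mono.
  + by rewrite -KE inE C2_set0 // lecR.
  + by rewrite -KE inE C2_set1 lecR.
Qed.
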